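(* Let $M=(E,\mathcal{I})$ be a loopless matroid (i.e. no element is a loop and no element is a coloop), let $e\in E$, and let $x:E\to\mathbb{R}$ be a weighting. Then (a) $\tau_{M/e}(x)=\tau_M(x)-\beta_x(e)$; (b) $\tau_{M\setminus e}(x)=\tau_M(x)-\beta_x(e)+\mu_x(e)$.
   Context: A matroid $M=(E,\mathcal{I})$ on a finite ground set $E$ has independent sets $\mathcal{I}$; bases are maximal independent sets, circuits are minimal dependent sets, and an $e$-circuit is a circuit containing $e$. An element $e$ is a loop if $\{e\}$ is dependent and a coloop if it belongs to every basis; $M$ is called loopless if it has neither loops nor coloops. For a weighting $x:E\to\mathbb{R}$ and $F\subseteq E$, $x(F)=\sum_{f\in F}x(f)$, and $\tau_M(x)=\min_{B \text{ basis of } M} x(B)$ is the minimum weight of a basis. The min-max weight of $e$ is $\mu_x(e)=\min_{C\ e\text{-circuit}}\ \max_{f\in C\setminus\{e\}} x(f)$, and the bottleneck weight is $\beta_x(e)=\min\{x(e),\mu_x(e)\}$. The contraction $M/e$ has ground set $E\setminus\{e\}$ and independent sets $\{I\setminus\{e\}: I\in\mathcal{I}, e\in I\}$; the deletion $M\setminus e$ has ground set $E\setminus\{e\}$ and independent sets $\{I\in\mathcal{I}: e\notin I\}$. Weightings of $E$ are restricted to $E\setminus\{e\}$ when applied to $M/e$ and $M\setminus e$. *)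

(* Defs.v *)
From mathcomp Require Import all_boot all_order all_algebra.
From mathcomp Require Import reals.

Set Implicit Arguments.
Unset Strict Implicit.
Unset Printing Implicit Defensive.

Import Order.TTheory GRing.Theory Num.Theory.
Local Open Scope ring_scope.

(* A pair (E, I): E is a subset of an ambient finite type T, so that M / e and
   M \ e, whose ground set is E \ {e}, live over the same type as M, and the
   restriction of a weighting x : T -> R needs no coercion.  Values of x outside
   the ground set are never used. *)
Record set_system (T : finType) := SetSystem {
  ground : {set T};
  indep : {set {set T}} }.

Record is_matroid (T : finType) (M : set_system T) : Prop := IsMatroid {
  indep_ground : forall I : {set T}, I \in indep M -> I \subset ground M;
  indep_empty : set0 \in indep M;
  indep_sub : forall I J : {set T}, J \in indep M -> I \subset J -> I \in indep M;
  indep_aug : forall I J : {set T}, I \in indep M -> J \in indep M -> (#|I| < #|J|)%N ->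
    exists2 f, f \in J :\: I & f |: I \in indep M }.

Definition dependent (T : finType) (M : set_system T) (A : {set T}) : bool :=
  (A \subset ground M) && (A \notin indep M).

Definition bases (T : finType) (M : set_system T) : {set {set T}} :=
  [set B | maxset (mem (indep M)) B].

Definition circuits (T : finType) (M : set_system T) : {set {set T}} :=
  [set C | minset (dependent M) C].

Definition ecircuits (T : finType) (M : set_system T) (e : T) : {set {set T}} :=
  [set C in circuits M | e \in C].

Definition loop (T : finType) (M : set_system T) (e : T) : Prop :=
  dependent M [set e].

Definition coloop (T : finType) (M : set_system T) (e : T) : Prop :=
  e \in ground M /\ forall B, B \in bases M -> e \in B.

(* "Loopless" excludes coloops as well as loops. *)
Definition loopless (T : finType) (M : set_system T) : Prop :=
  forall f, f \in ground M -> ~ loop M f /\ ~ coloop M f.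

Definition contract (T : finType) (M : set_system T) (e : T) : set_system T :=
  SetSystem (ground M :\ e) [set I :\ e | I in indep M & e \in I].

Definition delete (T : finType) (M : set_system T) (e : T) : set_system T :=
  SetSystem (ground M :\ e) [set I in indep M | e \notin I].

(* Minimum and maximum of a nonempty finite family; the value on the empty
   sequence is the junk value 0. *)
Definition seqmin (R : realType) (s : seq R) : R :=
  \big[Num.min/head 0 s]_(y <- s) y.

Definition seqmax (R : realType) (s : seq R) : R :=
  \big[Num.max/head 0 s]_(y <- s) y.

Definition weight (T : finType) (R : realType) (x : T -> R) (F : {set T}) : R :=
  \sum_(f in F) x f.

Definition tau (T : finType) (R : realType) (M : set_system T) (x : T -> R) : R :=
  seqmin [seq weight x B | B in bases M].

Definition mu (T : finType) (R : realType) (M : set_system T) (x : T -> R)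
    (e : T) : R :=
  seqmin [seq seqmax [seq x f | f in C :\ e] | C in ecircuits M e].

Definition beta (T : finType) (R : realType) (M : set_system T) (x : T -> R)
    (e : T) : R :=
  Num.min (x e) (mu M x e).

Lemma seqmin_mem (R : realType) (s : seq R) : s != [::] -> seqmin s \in s.
Proof.
case: s => // a s _; rewrite /seqmin /= big_seq.
apply: (big_ind (fun y => y \in a :: s)) => //; first exact: mem_head.
by move=> y z ys zs; rewrite minElt; case: ifP.
Qed.

Lemma seqmin_le (R : realType) (s : seq R) (y : R) : y \in s -> seqmin s <= y.
Proof.
rewrite /seqmin; move: (head 0 s) => d.
elim: s => // a s IHs; rewrite inE big_cons ge_min => /predU1P[->|/IHs ->].
  by rewrite lexx.
by rewrite orbT.
Qed.

Lemma seqmax_mem (R : realType) (s : seq R) : s != [::] -> seqmax s \in s.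
Proof.
case: s => // a s _; rewrite /seqmax /= big_seq.
apply: (big_ind (fun y => y \in a :: s)) => //; first exact: mem_head.
by move=> y z ys zs; rewrite maxElt; case: ifP.
Qed.

Lemma seqmax_ge (R : realType) (s : seq R) (y : R) : y \in s -> y <= seqmax s.
Proof.
rewrite /seqmax; move: (head 0 s) => d.
elim: s => // a s IHs; rewrite inE big_cons le_max => /predU1P[->|/IHs ->].
  by rewrite lexx.
by rewrite orbT.
Qed.

Lemma delete_matroid (T : finType) (M : set_system T) (e : T) :
  is_matroid M -> is_matroid (delete M e).
Proof.
case=> gM M0 Ms Ma; split=> /=.
- by move=> I; rewrite inE subsetD1 => /andP[/gM-> ->].
- by rewrite inE M0 inE.
- move=> I J; rewrite !inE => /andP[JM eJ] IJ; rewrite (Ms _ _ JM IJ) /=.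
  by apply: contraNN eJ => /(subsetP IJ).
- move=> I J; rewrite !inE => /andP[IM eI] /andP[JM eJ] ltIJ.
  have [f fJI fI] := Ma _ _ IM JM ltIJ; exists f => //.
  rewrite !inE fI negb_or eI andbT /=; apply: contraNneq eJ => ->.
  by move: fJI; rewrite inE => /andP[].
Qed.

Lemma contract_matroid (T : finType) (M : set_system T) (e : T) :
  is_matroid M -> e \in ground M -> ~ loop M e -> is_matroid (contract M e).
Proof.
case=> gM M0 Ms Ma eE nl.
have eM : [set e] \in indep M.
  by apply/negPn/negP=> ne; apply: nl; rewrite /loop /dependent sub1set eE.
split=> /=.
- by move=> I' /imsetP[I]; rewrite inE => /andP[/gM IE _] ->; rewrite setSD.
- apply/imsetP; exists [set e]; first by rewrite inE eM set11.
  by rewrite setDv.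
- move=> I J' /imsetP[J]; rewrite inE => /andP[JM eJ] -> IJ.
  have eI : e \notin I by apply/negP=> /(subsetP IJ); rewrite !inE eqxx.
  apply/imsetP; exists (e |: I); last by rewrite setU1K.
  rewrite inE setU11 andbT; apply: Ms JM _.
  by rewrite subUset sub1set eJ (subset_trans IJ) ?subsetDl.
- move=> I' J' /imsetP[I]; rewrite inE => /andP[IM eI] ->.
  move=> /imsetP[J]; rewrite inE => /andP[JM eJ] -> ltIJ.
  have ltIJ' : (#|I| < #|J|)%N by rewrite (cardsD1 e I) eI (cardsD1 e J) eJ.
  have [f fJI fI] := Ma _ _ IM JM ltIJ'.
  move: fJI; rewrite inE => /andP[nfI fJ].
  have fe : f != e by apply: contraNneq nfI => ->.
  exists f; first by rewrite !inE fe fJ (negPf nfI).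
  apply/imsetP; exists (f |: I); first by rewrite inE fI !inE eI orbT.
  apply/setP=> g; rewrite !inE.
  by have [->|//] := eqVneq g f; rewrite fe.
Qed.

(* Main.v *)
Require Import Defs.
From mathcomp Require Import all_boot all_order all_algebra.
From mathcomp Require Import reals.

(** Bases of [M / e] are the bases of [M] through [e] with [e] removed, and bases
    of [M \ e] are the bases of [M] avoiding [e], so
    [tau M = min (tau (M / e) + x e) (tau (M \ e))].  Both claims follow from
    [tau (M \ e) = tau (M / e) + mu e].  For [<=], exchange [e] out of an optimal
    basis through [e] against some element of an optimal [e]-circuit; for [>=],
    exchange the heaviest element [f <> e] of the fundamental circuit of [e] out
    of an optimal basis avoiding [e]. *)

Import Order.TTheory GRing.Theory Num.Theory.
Local Open Scope ring_scope.

(** * Attained extrema of finite families *)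

Section SeqMin.

Variables (T : finType) (R : realType) (f : T -> R) (A : {pred T}).

Lemma seqmin_image_le i : i \in A -> seqmin [seq f j | j in A] <= f i.
Proof. by move=> iA; apply/seqmin_le/image_f. Qed.

(** The witness [i0] makes the family nonempty, which excludes the junk value of [seqmin]. *)
Lemma seqmin_imageP i0 : i0 \in A ->
  exists2 i, i \in A & seqmin [seq f j | j in A] = f i.
Proof.
move=> i0A; apply/imageP/seqmin_mem.
by apply: contraTneq (image_f f i0A) => ->.
Qed.

Lemma seqmax_image_ge i : i \in A -> f i <= seqmax [seq f j | j in A].
Proof. by move=> iA; apply/seqmax_ge/image_f. Qed.

Lemma seqmax_imageP i0 : i0 \in A ->
  exists2 i, i \in A & seqmax [seq f j | j in A] = f i.
Proof.
move=> i0A; apply/imageP/seqmax_mem.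
by apply: contraTneq (image_f f i0A) => ->.
Qed.

End SeqMin.

Lemma weightU1 (T : finType) (R : realType) (x : T -> R) (e : T) (A : {set T}) :
  e \notin A -> weight x (e |: A) = x e + weight x A.
Proof. exact: big_setU1. Qed.

Lemma weightD1 (T : finType) (R : realType) (x : T -> R) (e : T) (A : {set T}) :
  e \in A -> weight x A = x e + weight x (A :\ e).
Proof. exact: big_setD1. Qed.

(** * Bases of a matroid and of its minors *)

Section Matroid.

Variables (T : finType) (M : set_system T).
Hypothesis matM : is_matroid M.
Implicit Types (A B C I J : {set T}) (e f g : T).

Lemma indep_extend I A : I \in indep M -> I \subset A ->
  exists J, [/\ J \in indep M, I \subset J, J \subset A &
    forall g, g \in A -> g |: J \in indep M -> g \in J].
Proof.
move=> IM IA; pose P J := (J \in indep M) && (J \subset A).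
have [|J /maxsetP[/andP[JM JA] Jmax] IJ] := @maxset_exists _ P I.
  by rewrite /P IM.
exists J; split=> // g gA gJ; rewrite -(Jmax (g |: J)) ?setU11 ?subsetUr //.
by rewrite /P gJ subUset sub1set gA.
Qed.

(** Augmentation turns maximality for inclusion into maximality for cardinality, so bases can be
    recognised by counting. *)
Lemma basisP B : reflect
  (B \in indep M /\ forall J, J \in indep M -> (#|J| <= #|B|)%N)
  (B \in bases M).
Proof.
rewrite inE; apply: (iffP maxsetP) => -[BM Bmax]; split=> // J JM.
  rewrite leqNgt; apply/negP => ltBJ.
  have [f /setDP[_ /negP fB] fBM] := indep_aug matM BM JM ltBJ.
  by apply: fB; rewrite -(Bmax _ fBM) ?setU11 ?subsetUr.
by move=> BJ; apply/esym/eqP; rewrite eqEcard BJ Bmax.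
Qed.

Lemma basis_card B I : B \in bases M -> I \in indep M -> (#|B| <= #|I|)%N ->
  I \in bases M.
Proof.
move=> /basisP[_ Bmax] IM BI; apply/basisP; split=> // J JM.
exact: leq_trans (Bmax J JM) BI.
Qed.

Lemma indep_contract e I :
  (I \in indep (contract M e)) = (e \notin I) && (e |: I \in indep M).
Proof.
apply/imsetP/andP=> [[J]|[eI IM]].
  by rewrite inE => /andP[JM eJ] ->; rewrite setD11 setD1K.
by exists (e |: I); rewrite ?setU1K // inE IM setU11.
Qed.

(** Adding [e] is an inclusion-preserving bijection from the independent sets of [M / e] to those of
    [M] through [e], and every superset of [e |: B] contains [e], so maximality transfers both
    ways. *)
Lemma bases_contract e B :
  (B \in bases (contract M e)) = (e \notin B) && (e |: B \in bases M).
Proof.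
rewrite !inE; apply/maxsetP/andP.
  rewrite /= indep_contract => -[/andP[eB BM] Bmax]; split=> //.
  apply/maxsetP; split=> // J JM; rewrite subUset sub1set => /andP[eJ BJ].
  rewrite -(Bmax (J :\ e)) ?setD1K ?subsetD1 ?BJ //.
  by rewrite /= indep_contract setD11 setD1K.
move=> [eB /maxsetP[BM Bmax]]; split; first by rewrite /= indep_contract eB.
move=> J; rewrite /= indep_contract => /andP[eJ JM] BJ.
by rewrite -(setU1K eJ) (Bmax _ JM) ?setUS // setU1K.
Qed.

(** A maximal independent set avoiding [e] is as large as [B0]: augmenting it from [B0] would never
    add [e]. *)
Lemma bases_delete e B0 B : B0 \in bases M -> e \notin B0 ->
  (B \in bases (delete M e)) = (e \notin B) && (B \in bases M).
Proof.
move=> B0M eB0; have [B0I _] := basisP _ B0M.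
apply/idP/andP=> [|[eB /basisP[BM Bmax]]].
  rewrite inE => /maxsetP[/=]; rewrite inE => /andP[BM eB] Bmax; split=> //.
  apply: (basis_card _ _ B0M BM); rewrite leqNgt; apply/negP => ltB.
  have [f /setDP[fB0 /negP fB] fBM] := indep_aug matM BM B0I ltB.
  apply: fB; rewrite -(Bmax (f |: B)) ?setU11 ?subsetUr //.
  by rewrite !inE fBM negb_or eB andbT; apply: contraNneq eB0 => ->.
rewrite inE; apply/maxsetP; split=> /= [|J]; first by rewrite inE BM.
by rewrite inE => /andP[JM _] BJ; apply/esym/eqP; rewrite eqEcard BJ Bmax.
Qed.

(** * Circuits and basis exchange *)

Lemma circuit_dep C : C \in circuits M -> C \notin indep M.
Proof. by rewrite inE => /minsetP[/andP[]]. Qed.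

Lemma circuitD1_indep C f : C \in circuits M -> f \in C -> C :\ f \in indep M.
Proof.
rewrite inE => /minsetP[/andP[CE _] Cmin] fC; apply/negPn/negP => dC.
suff : f \in C :\ f by rewrite setD11.
by rewrite (Cmin (C :\ f)) ?subD1set // /dependent dC (subset_trans _ CE) ?subD1set.
Qed.

(** Being larger than a basis, [e |: B] is dependent; a minimal dependent subset without [e] would
    lie in the independent set [B]. *)
Lemma fundamental_circuit B e : e \in ground M -> B \in bases M -> e \notin B ->
  exists2 C, C \in ecircuits M e & C \subset e |: B.
Proof.
move=> eE /basisP[BM Bmax] eB.
have [|C Cmin CeB] := @minset_exists _ (dependent M) (e |: B).
  rewrite /dependent subUset sub1set eE (indep_ground matM BM) /=.
  by apply/negP => /Bmax; rewrite cardsU1 eB ltnn.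
exists C => //; rewrite !inE Cmin; apply/negPn/negP => eC.
have [/andP[_ /negP dC] _] := minsetP Cmin.
apply: dC; apply: (indep_sub matM) BM _.
apply/subsetP => g gC; have := subsetP CeB g gC; rewrite !inE.
by case/predU1P=> // ge; rewrite -ge gC in eC.
Qed.

(** Grow [C :\ f] to a maximal independent [J] inside [e |: B]. It misses [f], as [C] is dependent,
    and has at least [#|B|] elements by augmentation from [B], so it must be all of
    [e |: B :\ f]. *)
Lemma circuit_exchange_in B e C f : B \in bases M -> e \notin B ->
  C \in ecircuits M e -> C \subset e |: B -> f \in C :\ e ->
  e |: B :\ f \in bases M.
Proof.
move=> BM eB; rewrite inE => /andP[CM eC] CeB /setD1P[fe fC].
have [BI _] := basisP _ BM.
have CfeB : C :\ f \subset e |: B by rewrite (subset_trans _ CeB) ?subD1set.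
have [J [JM CfJ JeB Jmax]] := indep_extend _ _ (circuitD1_indep _ _ CM fC) CfeB.
have fJ : f \notin J.
  apply: contra (circuit_dep _ CM) => fJ; apply: (indep_sub matM) JM _.
  by rewrite -(setD1K fC) subUset sub1set fJ.
have leBJ : (#|B| <= #|J|)%N.
  rewrite leqNgt; apply/negP => ltJB.
  have [g /setDP[gB /negP gJ] gJM] := indep_aug matM JM BI ltJB.
  by apply: gJ; apply: Jmax; rewrite // !inE gB orbT.
have fB : f \in B.
  by have := subsetP CeB f fC; rewrite !inE (negPf fe).
suff <- : J = e |: B :\ f by apply: basis_card BM JM leBJ.
apply/eqP; rewrite eqEcard cardsU1 !inE (negPf eB) andbF /=.
rewrite (leq_trans _ leBJ) ?[X in (_ <= X)%N](cardsD1 f) ?fB // andbT.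
apply/subsetP => g gJ; have := subsetP JeB g gJ; rewrite !inE.
by case: (eqVneq g f) => // gf; rewrite -gf gJ in fJ.
Qed.

(** Grow [C :\ e] to a maximal independent [J] inside the union of [B :\ e] and [C :\ e]. Once [J]
    is larger than [B :\ e], augmenting [B :\ e] from [J] can only add an element of [C :\ e]. *)
Lemma circuit_exchange_out B e C : B \in bases M -> e \in B ->
  C \in ecircuits M e ->
  exists2 f, f \in C :\ e & (f \notin B) && (f |: B :\ e \in bases M).
Proof.
move=> BM eB; rewrite inE => /andP[CM eC]; have [BI _] := basisP _ BM.
set I := B :\ e; have cB : #|B| = #|I|.+1 by rewrite (cardsD1 e) eB.
have IM : I \in indep M by apply: (indep_sub matM) BI _; apply: subD1set.
have [J [JM CJ JIC Jmax]] :=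
  indep_extend _ _ (circuitD1_indep _ _ CM eC) (subsetUr I (C :\ e)).
case: (ltnP #|I| #|J|) => [ltIJ|leJI].
  have [f /setDP[fJ fI] fIM] := indep_aug matM IM JM ltIJ.
  have fC : f \in C :\ e.
    by have := subsetP JIC f fJ; rewrite inE (negPf fI).
  exists f => //; apply/andP; split.
    by move: fI fC; rewrite !inE negb_and negbK => /orP[->|].
  by apply: basis_card BM fIM _; rewrite cardsU1 fI cB.
(* A small [J] is impossible: augmented from [B], it gains either [e], and then contains the circuit
   [C], or an element of [B :\ e], against its maximality. *)
have ltJB : (#|J| < #|B|)%N by rewrite cB ltnS.
have [g /setDP[gB /negP gJ] gJM] := indep_aug matM JM BI ltJB.
have [ge|ge] := eqVneq g e.
  case/negP: (circuit_dep _ CM); apply: (indep_sub matM) gJM _.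
  by rewrite ge -(setD1K eC) setUS.
by case: gJ; apply: Jmax; rewrite // !inE ge gB.
Qed.

(** * Minimum weights of bases in the two minors *)

Section Weights.

Variables (R : realType) (x : T -> R) (e : T).
Hypotheses (eE : e \in ground M) (nloop : ~ loop M e) (ncoloop : ~ coloop M e).

(** This lemma and the next show that [M / e] and [M \ e] have bases coming from [M], so that their
    [tau] is attained; here the absence of loops and coloops enters. *)
Lemma basis_with : exists2 B, B \in bases M & e \in B.
Proof.
have eM : [set e] \in indep M.
  by apply/negPn/negP => ne; apply: nloop; rewrite /loop /dependent sub1set eE.
have [B Bmax eB] := @maxset_exists _ (mem (indep M)) [set e] eM.
by exists B; rewrite ?inE // -sub1set.
Qed.

Lemma basis_without : exists2 B, B \in bases M & e \notin B.
Proof.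
have [/exists_inP[B BM eB]|noB] :=
  boolP [exists B in bases M, e \notin B]; first by exists B.
case: ncoloop; split=> // B BM; apply/negPn/negP => eB.
by case/exists_inP: noB; exists B.
Qed.

Lemma tau_contractP :
  exists B, [/\ B \in bases M, e \in B & tau (contract M e) x = weight x (B :\ e)].
Proof.
have [B BM eB] := basis_with.
have BcM : B :\ e \in bases (contract M e).
  by rewrite bases_contract setD11 setD1K.
have [B'] := seqmin_imageP _ _ (weight x) _ _ BcM.
rewrite bases_contract => /andP[eB' B'M] E.
by exists (e |: B'); rewrite setU11 setU1K.
Qed.

Lemma tau_contract_le B : B \in bases M -> e \in B ->
  tau (contract M e) x <= weight x (B :\ e).
Proof.
by move=> BM eB; apply: seqmin_image_le; rewrite bases_contract setD11 setD1K.
Qed.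

Lemma tau_deleteP :
  exists B, [/\ B \in bases M, e \notin B & tau (delete M e) x = weight x B].
Proof.
have [B BM eB] := basis_without.
have BdM : B \in bases (delete M e) by rewrite (bases_delete _ _ _ BM eB) eB.
have [B'] := seqmin_imageP _ _ (weight x) _ _ BdM.
by rewrite (bases_delete _ _ _ BM eB) => /andP[eB' B'M] E; exists B'.
Qed.

Lemma tau_delete_le B : B \in bases M -> e \notin B ->
  tau (delete M e) x <= weight x B.
Proof.
by move=> BM eB; apply: seqmin_image_le; rewrite (bases_delete _ _ _ BM eB) eB.
Qed.

Lemma tau_min :
  tau M x = Num.min (tau (contract M e) x + x e) (tau (delete M e) x).
Proof.
have [Bc [BcM eBc tauc]] := tau_contractP.
have [Bd [BdM eBd taud]] := tau_deleteP.
apply/le_anti/andP; split.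
  rewrite le_min tauc taud addrC -weightD1 //.
  by apply/andP; split; apply: seqmin_image_le.
have [B BM] := seqmin_imageP _ _ (weight x) _ _ BcM.
rewrite -/(tau M x) => ->; rewrite ge_min.
have [eB|eB] := boolP (e \in B); last by rewrite tau_delete_le ?orbT.
by rewrite (weightD1 _ _ _ _ _ eB) addrC lerD2l tau_contract_le.
Qed.

Lemma tau_delete_contract :
  tau (delete M e) x = tau (contract M e) x + mu M x e.
Proof.
have [Bc [BcM eBc tauc]] := tau_contractP.
have [Bd [BdM eBd taud]] := tau_deleteP.
have [C CM CBd] := fundamental_circuit _ _ eE BdM eBd.
apply/le_anti/andP; split.
  have [C' C'M] :=
    seqmin_imageP _ _ (fun C => seqmax [seq x f | f in C :\ e]) _ _ CM.
  rewrite -/(mu M x e) => ->.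
  have [f fC' /andP[fB fBM]] := circuit_exchange_out _ _ _ BcM eBc C'M.
  have fe : f != e by case/setD1P: fC'.
  apply: le_trans (tau_delete_le _ fBM _) _.
    by rewrite !inE eqxx eq_sym (negPf fe).
  rewrite weightU1 ?inE ?(negPf fB) ?andbF // tauc addrC lerD2l.
  exact: (seqmax_image_ge _ _ x (mem (C' :\ e))).
(* The exchange only serves to show that [C :\ e] is nonempty, so that its [seqmax] is attained. *)
have [f0 f0C _] := circuit_exchange_out _ _ _ BcM eBc CM.
have [f fC fmax] := seqmax_imageP _ _ x (mem (C :\ e)) _ f0C.
have fB : f \in Bd.
  by case/setD1P: fC => fe /(subsetP CBd); rewrite !inE (negPf fe).
(* Split off [f] from [Bd]: [x f] is the maximum over one [e]-circuit, hence at least [mu], and the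
   rest is a basis through [e] with [e] removed. *)
rewrite taud (weightD1 _ _ _ _ _ fB) addrC lerD //.
  rewrite -fmax.
  exact: (seqmin_image_le _ _ (fun C => seqmax [seq x f | f in C :\ e])).
have eBf : e \notin Bd :\ f by rewrite !inE (negPf eBd) andbF.
rewrite -(setU1K eBf) tau_contract_le ?setU11 //.
exact: circuit_exchange_in CBd fC.
Qed.

End Weights.

End Matroid.

Theorem mainTheorem1 (T : finType) (R : realType) (M : set_system T)
    (matM : is_matroid M) (llM : loopless M) (e : T) (he : e \in ground M)
    (x : T -> R) :
  tau (contract M e) x = tau M x - beta M x e /\
  tau (delete M e) x = tau M x - beta M x e + mu M x e.
Proof.
have [nloop ncoloop] := llM e he.
have taud := tau_delete_contract _ _ matM _ x _ he nloop ncoloop.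
have tauM : tau M x = tau (contract M e) x + beta M x e.
  (* Both arguments of the minimum share the summand [tau (contract M e) x]; factoring it out leaves
     the minimum of [x e] and [mu M x e]. *)
  by rewrite (tau_min _ _ matM _ x _ he nloop ncoloop) taud -addr_minr.
by rewrite taud tauM addrK.
Qed.
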